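(* Let $\Pi\subseteq[l]^m$ be a set of nondecreasing patterns $\pi=1^{a_1(\pi)}2^{a_2(\pi)}\cdots l^{a_l(\pi)}$. For each $\pi\in\Pi$, let $\hat\pi\in S_m$ be the layered permutation $\hat\pi=[a_1(\pi),\dots,a_l(\pi)]$, and let $\hat\Pi=\{\hat\pi:\pi\in\Pi\}$. Then $\delta(\Pi,k)=\delta_k(\hat\Pi)$ for every $k\ge 1$, and $\delta'(\Pi)=\delta(\Pi)=\delta(\hat\Pi)$.
   Context: $[k]=\{1,\dots,k\}$ and $[k]^n$ is the set of words of length $n$ over $[k]$; permutations in $S_n$ are regarded as words in $[n]^n$. For a letter $a$ and an integer $j\ge1$, $a^j$ denotes the word $a\cdots a$ ($j$ copies); so all $a_i(\pi)\ge 1$. Two words $u,v$ of the same length are order-isomorphic if for all positions $i,j$: $u_i<u_j\iff v_i<v_j$. An occurrence of a pattern $\pi$ of length $m$ in a word $\sigma$ is a subsequence of $\sigma$ (a choice of positions $i_1<\dots<i_m$) order-isomorphic to $\pi$. For a set $\Pi$ of patterns of length $m$, $\nu(\Pi,\sigma)$ is the number of length-$m$ subsequences (position sets) of $\sigma$ that are an occurrence of some pattern in $\Pi$. For $n\ge m$, $\delta(\Pi,k,n)=\max\{\nu(\Pi,\sigma):\sigma\in[k]^n\}/\binom{n}{m}$. Further, $$\delta(\Pi)=\lim_{n\to\infty}\delta(\Pi,n,n)=\lim_{n\to\infty}\lim_{k\to\infty}\delta(\Pi,k,n),\qquad \delta(\Pi,k)=\lim_{n\to\infty}\delta(\Pi,k,n),\qquad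 \delta'(\Pi)=\lim_{k\to\infty}\delta(\Pi,k)$$ (all these limits exist). A layered permutation is one that is a concatenation of strictly decreasing nonempty substrings (its layers) such that every letter of an earlier layer is smaller than every letter of a later layer. It is determined by its sequence of layer lengths, and $[a_1,\dots,a_l]$ denotes the layered permutation with layer lengths $a_1,\dots,a_l$ from left to right (e.g. $[3,2,4]=321549876$). For a set $\hat\Pi\subseteq S_m$ of layered permutations, $\delta_k(\hat\Pi)$ (the $k$-layer packing density) is the packing density of $\hat\Pi$ among layered permutations with at most $k$ layers: $\delta_k(\hat\Pi)=\lim_{n\to\infty}\max\{\nu(\hat\Pi,\sigma):\sigma\in S_n\text{ layered with at most }k\text{ layers}\}/\binom{n}{m}$. *)

(* Defs.v *)
From HB Require Import structures.
From mathcomp Require Import all_boot all_order all_algebra all_fingroup.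
From mathcomp Require Import boolp classical_sets reals topology normedtype.
From mathcomp Require Import sequences.

Set Implicit Arguments.
Unset Strict Implicit.
Unset Printing Implicit Defensive.

Import Order.TTheory GRing.Theory Num.Theory.
Import numFieldNormedType.Exports.

Local Open Scope nat_scope.

(* The alphabet [k] is 'I_k, so that letters are numbered from 0. *)
Notation word k n := (n.-tuple 'I_k).

Definition letters (k : nat) (w : seq 'I_k) : seq nat := map val w.

Definition order_iso (u v : seq nat) : bool :=
  (size u == size v) &&
  [forall i : 'I_(size u), forall j : 'I_(size u),
     (nth 0 u i < nth 0 u j) == (nth 0 v i < nth 0 v j)].

(* [enum S] lists the positions of [S] in increasing order. *)
Definition subword (k n : nat) (sigma : word k n) (S : {set 'I_n}) :
    seq 'I_k :=
  [seq tnth sigma i | i <- enum S].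

(* Patterns of [Pi] have length [m]; [order_iso] then forces [#|S| = m]. *)
Definition nu (l m k n : nat) (Pi : {set word l m}) (sigma : word k n) : nat :=
  #|[set S : {set 'I_n} |
      [exists pi in Pi, order_iso (letters pi) (letters (subword sigma S))]]|.

Definition word_of_perm (n : nat) (s : 'S_n) : word n n := [tuple s i | i < n].

Definition words_of_perms (n : nat) (A : {set 'S_n}) : {set word n n} :=
  [set word_of_perm s | s in A].

(* [w] is the concatenation of strictly decreasing nonempty layers of lengths
   [a], each letter of a layer being smaller than each letter of any later
   layer. *)
Definition has_layers (a : seq nat) (w : seq nat) : bool :=
  [&& all (leq 1) a, sumn a == size w,
      all (sorted gtn) (reshape a w) &
      pairwise (allrel ltn) (reshape a w)].

Definition perm_has_layers (n : nat) (a : seq nat) (s : 'S_n) : bool :=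
  has_layers a (letters (word_of_perm s)).

Definition layered_at_most (n k : nat) (s : 'S_n) : Prop :=
  exists2 a : seq nat, size a <= k & perm_has_layers a s.

(* The sequence a_1(pi), ..., a_l(pi). *)
Definition mults (l m : nat) (pi : word l m) : seq nat :=
  [seq count_mem i pi | i <- enum 'I_l].

(* pi = 1^{a_1} 2^{a_2} ... l^{a_l} with every a_i at least 1. *)
Definition nondecreasing_pattern (l m : nat) (pi : word l m) : bool :=
  all (leq 1) (mults pi) &&
  (tval pi == flatten [seq nseq (count_mem i pi) i | i <- enum 'I_l]).

Fixpoint layered_word (c : nat) (a : seq nat) : seq nat :=
  if a is x :: a' then rev (iota c x) ++ layered_word (c + x) a' else [::].

Lemma layered_word_perm c a : perm_eq (layered_word c a) (iota c (sumn a)).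
Proof.
elim: a c => [|x a IHa] c //=; rewrite iotaD.
by apply: perm_cat; [rewrite perm_rev | apply: IHa].
Qed.

Lemma has_layers_word c a : all (leq 1) a -> has_layers a (layered_word c a).
Proof.
move=> a_gt0; rewrite /has_layers a_gt0 /= (perm_size (layered_word_perm c a)).
rewrite size_iota eqxx /=; elim: a a_gt0 c => //= x a IHa /andP[_ a_gt0] c.
rewrite take_size_cat ?drop_size_cat ?size_rev ?size_iota //.
have /andP[-> ->] := IHa a_gt0 (c + x); rewrite rev_sorted iota_ltn_sorted /= andbT.
apply/allP=> /= B B_a; apply/allrelP => i j; rewrite mem_rev mem_iota => /andP[_ i_lt] j_B.
have : j \in layered_word (c + x) a.
  rewrite -(@reshapeKr _ a (layered_word (c + x) a)); last first.
    by rewrite (perm_size (layered_word_perm _ _)) size_iota.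
  by apply/flattenP; exists B.
rewrite (perm_mem (layered_word_perm _ _)) mem_iota => /andP[le_j _].
exact: leq_trans i_lt le_j.
Qed.

Lemma has_layers_inj c a w :
  has_layers a w -> perm_eq w (iota c (sumn a)) -> w = layered_word c a.
Proof.
elim: a c w => [|x a IHa] c w /and4P[a_gt0 /eqP sz_w dec inc] w_perm.
  by apply/size0nil; rewrite -sz_w.
move: a_gt0 dec inc => /= /andP[_ a_gt0] /andP[dec_t dec_d] /andP[inc_t inc_d].
set t := take x w in dec_t inc_t; set d := drop x w in dec_d inc_d inc_t.
have sz_t : size t = x by rewrite size_takel // -sz_w leq_addr.
have sz_d : sumn a = size d by rewrite size_drop -sz_w /= addKn.
have w_td : w = t ++ d by rewrite cat_take_drop.
have lt_td : allrel ltn t d.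
  rewrite -(@reshapeKr _ a d) -?sz_d //; apply/allrelP => i j i_t.
  by case/flattenP => B /(allP inc_t) /allrelP; apply.
have sortE : iota c (x + sumn a) = rev t ++ sort leq d.
  apply: (sorted_eq leq_trans anti_leq); first exact: iota_sorted.
    rewrite sorted_pairwise; last exact: leq_trans.
    rewrite pairwise_cat -!sorted_pairwise; try exact: leq_trans.
    rewrite (sort_sorted leq_total) andbT; apply/andP; split.
      apply/allrelP => i j; rewrite mem_rev mem_sort => i_t j_d.
      by apply: ltnW; apply: (allrelP lt_td).
    rewrite rev_sorted; apply: sub_sorted dec_t => i j /=; exact: ltnW.
  rewrite perm_sym; apply: perm_trans w_perm; rewrite w_td.
  by apply: perm_cat; [rewrite perm_rev | rewrite perm_sort].
move: sortE; rewrite iotaD => /eqP; rewrite eqseq_cat ?size_iota ?size_rev //.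
case/andP=> /eqP tE /eqP dE; rewrite w_td /= tE revK; congr (_ ++ _).
apply: IHa; first by rewrite /has_layers a_gt0 sz_d eqxx dec_d inc_d.
by rewrite dE perm_sym perm_sort.
Qed.

Lemma letters_word_of_perm n (s : 'S_n) :
  letters (word_of_perm s) = [seq val (s i) | i <- enum 'I_n].
Proof. by rewrite /letters -map_comp. Qed.

Lemma layered_perm_unique n a : all (leq 1) a -> sumn a = n ->
  exists! s : 'S_n, perm_has_layers a s.
Proof.
move=> a_gt0 sum_a; set w := layered_word 0 a.
have w_perm : perm_eq w (iota 0 n) by rewrite -sum_a; apply: layered_word_perm.
have sz_w : size w = n by rewrite (perm_size w_perm) size_iota.
have w_lt (i : 'I_n) : nth 0 w i < n.
  have : nth 0 w i \in w by rewrite mem_nth // sz_w.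
  by rewrite (perm_mem w_perm) mem_iota.
have f_inj : injective (fun i => Ordinal (w_lt i)).
  move=> i j [] /eqP; rewrite nth_uniq ?sz_w // => [/eqP/val_inj //|].
  by rewrite (perm_uniq w_perm) iota_uniq.
exists (perm f_inj); split.
  rewrite /perm_has_layers letters_word_of_perm.
  suff -> : [seq val (perm f_inj i) | i <- enum 'I_n] = w by apply: has_layers_word.
  under eq_map do rewrite permE /=.
  by rewrite (map_comp (nth 0 w) val) val_enum_ord -/(mkseq _ _) -sz_w mkseq_nth.
move=> s; rewrite /perm_has_layers letters_word_of_perm => s_lay.
have s_perm : perm_eq [seq val (s i) | i <- enum 'I_n] (iota 0 (sumn a)).
  apply: uniq_perm; rewrite ?iota_uniq //.
    rewrite map_inj_uniq ?enum_uniq // => i j /val_inj; exact: perm_inj.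
  move=> j; rewrite mem_iota add0n sum_a; apply/mapP/idP => [[i _ ->]|lt_jn].
    exact: ltn_ord.
  by exists ((s^-1)%g (Ordinal lt_jn)); rewrite ?mem_enum //= permKV.
have sE := has_layers_inj s_lay s_perm.
apply/permP => i; apply: val_inj; rewrite permE /= /w -sE.
by rewrite (nth_map i) ?nth_ord_enum // size_enum_ord.
Qed.

Lemma sumn_mults l m (pi : word l m) :
  nondecreasing_pattern pi -> sumn (mults pi) = m.
Proof.
case/andP=> _ /eqP pi_flat; rewrite -[RHS](size_tuple pi) pi_flat size_flatten.
by rewrite /shape -map_comp; congr sumn; apply: eq_map => i /=; rewrite size_nseq.
Qed.

(* Each [pi] contributes exactly one permutation: see [layered_perm_unique]
   and [sumn_mults]. *)
Definition hat (l m : nat) (Pi : {set word l m}) : {set 'S_m} :=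
  [set s : 'S_m | [exists pi in Pi, perm_has_layers (mults pi) s]].

Local Open Scope ring_scope.

Definition density (R : realType) (l m : nat) (Pi : {set word l m})
    (k n : nat) : R :=
  (\max_(sigma : word k n) nu Pi sigma)%N%:R / 'C(n, m)%:R.

Definition layer_density (R : realType) (m : nat) (A : {set 'S_m})
    (k n : nat) : R :=
  (\max_(s : 'S_n | `[< layered_at_most k s >])
      nu (words_of_perms A) (word_of_perm s))%N%:R / 'C(n, m)%:R.

Definition delta (R : realType) (l m : nat) (Pi : {set word l m}) : R :=
  limn (fun n => density R Pi n n).

Definition delta_alphabet (R : realType) (l m : nat) (Pi : {set word l m})
    (k : nat) : R :=
  limn (fun n => density R Pi k n).

Definition delta_prime (R : realType) (l m : nat) (Pi : {set word l m}) : R :=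
  limn (fun k => delta_alphabet R Pi k).

Definition delta_layer (R : realType) (m : nat) (A : {set 'S_m}) (k : nat) : R :=
  limn (fun n => layer_density R A k n).

(* Main.v *)
Require Import Defs.
From mathcomp Require Import all_boot all_order all_algebra all_fingroup.
From mathcomp Require Import boolp classical_sets reals topology normedtype.
From mathcomp Require Import sequences.
From mathcomp Require Import lra.

Set Implicit Arguments.
Unset Strict Implicit.
Unset Printing Implicit Defensive.

Import Order.TTheory GRing.Theory Num.Theory.
Import numFieldNormedType.Exports.

Local Open Scope nat_scope.

(** Every identity of densities comes from an exact identity, valid for each
    length [n], between maximal numbers of occurrences; limits are taken only
    at the end.

    An occurrence of [1^{a_1} ... l^{a_l}] in a word is a set [S] of positions
    cut into classes of sizes [a_1, ..., a_l] such that positions of different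
    classes are ordered by a relation [R] (an earlier position carrying a
    smaller letter) and positions of one class are related by [E] (equality of
    letters).  An occurrence of the layered permutation with layer lengths
    [a_1, ..., a_l] is the same thing for the same [R], with [E] replaced by
    being inverted.  So both kinds of occurrences are counted by [labelled Pi R
    E], and inequalities follow from maps of positions that preserve [R] and
    [E] ([leq_labelled]).

    Layers against letters.  The position constraint in [R] can be dropped for
    words, because rearranging a word in nondecreasing order loses no
    occurrence; the rearranged word, read with its constant runs reversed into
    layers, is a layered permutation with at most [k] layers.  This gives
    [max_word_layered]: words over [k] letters and layered permutations with at
    most [k] layers have the same maximum.

    Layered permutations are optimal.  For the patterns of [hat Pi], Zykov
    symmetrization applies: if two points [x], [y] of a word are inverted, then
    replacing [x] by a clone of [y] or [y] by a clone of [x] (a clone being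
    inverted with its original) does not lower the number of occurrences
    ([labelled_merge]).  Repeating this ends with all inverted points equal,
    that is, with a layered configuration ([labelled_collapse]), whence
    [max_word_hat].

    Limits.  Deleting a letter shows that the densities [M k n / 'C(n, m)] of
    the maxima [M] do not increase with [n >= m]; duplicating a letter, which
    needs no new letter of the alphabet, shows that the quotients
    [M k n / (n (n+1) ... (n+m-1))] do not decrease with [n >= 1].  The two
    denominators agree asymptotically up to the factor [m!], so the limit over
    [n] for the alphabet of size [k] lies between the density at [n = k], up to
    a factor tending to 1, and the limit of the diagonal densities: this
    exchanges the limits in [diagonal_limit]. *)

(** * Occurrences as labellings *)

(** The label of a position is the letter of the pattern that it plays.  Labels
    are natural numbers rather than letters so that a labelling can be extended
    by a default value even when the alphabet is empty. *)
Definition labelling (I : finType) (R E : rel I) (p : seq nat) (S : {set I})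
    (h : I -> nat) : Prop :=
  perm_eq [seq h i | i <- enum S] p /\
  {in S &, forall i j, (h i < h j -> R i j) /\ (h i = h j -> E i j)}.

Definition labellable (l m : nat) (Pi : {set word l m}) (I : finType)
    (R E : rel I) (S : {set I}) : Prop :=
  exists2 pi, pi \in Pi & exists h, labelling R E (letters pi) S h.

Definition labelled (l m : nat) (Pi : {set word l m}) (I : finType)
    (R E : rel I) : {set {set I}} := [set S | `[< labellable Pi R E S >]].

Lemma labelledP l m (Pi : {set word l m}) (I : finType) (R E : rel I) S :
  reflect (labellable Pi R E S) (S \in labelled Pi R E).
Proof. by rewrite finset.in_set; apply: asboolP. Qed.

Lemma labellable_card l m (Pi : {set word l m}) (I : finType) (R E : rel I) S :
  labellable Pi R E S -> #|S| = m.
Proof.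
case=> pi _ [h [/perm_size + _]].
by rewrite /letters !size_map -cardE size_tuple.
Qed.

Lemma perm_enum_imset (I J : finType) (f : I -> J) (S : {set I}) :
  {in S &, injective f} -> perm_eq (enum (f @: S)) [seq f i | i <- enum S].
Proof.
move=> f_inj; apply: uniq_perm; first exact: enum_uniq.
  rewrite map_inj_in_uniq ?enum_uniq // => i j; rewrite !mem_enum; exact: f_inj.
move=> j; rewrite mem_enum; apply/imsetP/mapP => -[i iS ->]; exists i => //.
  by rewrite mem_enum.
by rewrite mem_enum in iS.
Qed.

(** A labelling moves along any map that is injective on [S] and preserves both
    relations there. *)
Lemma labellable_imset l m (Pi : {set word l m}) (I J : finType)
    (f : I -> J) (R E : rel I) (R' E' : rel J) (S : {set I}) :
    {in S &, injective f} ->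
    {in S &, forall i j, R i j -> R' (f i) (f j)} ->
    {in S &, forall i j, E i j -> E' (f i) (f j)} ->
  labellable Pi R E S -> labellable Pi R' E' (f @: S).
Proof.
move=> f_inj RR' EE' [pi piP [h [h_pi h_lab]]]; exists pi => //.
pose g j := if [pick i in S | f i == j] is Some i then h i else 0.
have gf i : i \in S -> g (f i) = h i.
  move=> iS; rewrite /g; case: pickP => [i' /andP[i'S /eqP/f_inj->] //|].
  by move/(_ i); rewrite iS eqxx.
exists g; split.
  apply: perm_trans h_pi; apply: (perm_trans (perm_map g (perm_enum_imset f_inj))).
  rewrite -map_comp; rewrite (@eq_in_map _ _ (g \o f) h (enum S)).1 // => i.
  by rewrite mem_enum => /gf.
move=> _ _ /imsetP[i iS ->] /imsetP[j jS ->]; rewrite !gf //.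
have [hR hE] := h_lab i j iS jS.
by split=> [/hR|/hE]; [apply: RR' | apply: EE'].
Qed.

Lemma labellable_relpre l m (Pi : {set word l m}) (I J : finType)
    (f : I -> J) (R E : rel J) (S : {set I}) :
    {in S &, injective f} -> labellable Pi R E (f @: S) ->
  labellable Pi (relpre f R) (relpre f E) S.
Proof.
move=> f_inj [pi piP [h [h_pi h_lab]]]; exists pi => //; exists (h \o f); split.
  apply: perm_trans h_pi; rewrite (map_comp h f); apply: perm_map.
  by rewrite perm_sym; apply: perm_enum_imset.
by move=> i j iS jS; apply: h_lab; apply: imset_f.
Qed.

(** The source of every comparison of occurrence counts between two words. *)
Lemma leq_labelled l m (Pi : {set word l m}) (I J : finType) (f : I -> J)
    (R E : rel I) (R' E' : rel J) :
    injective f ->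
    (forall i j, R i j -> R' (f i) (f j)) ->
    (forall i j, E i j -> E' (f i) (f j)) ->
  #|labelled Pi R E| <= #|labelled Pi R' E'|.
Proof.
move=> f_inj RR' EE'; rewrite -(card_imset _ (imset_inj f_inj)).
apply/subset_leq_card/fintype.subsetP => U.
case/imsetP => S /labelledP SL ->.
by apply/labelledP; apply: labellable_imset SL => i j _ _; auto.
Qed.

(** Double counting of the pairs of an occurrence and a point outside it: each
    occurrence survives the deletion of the [n + 1 - m] points it avoids. *)
Lemma labelled_delete l m (Pi : {set word l m}) n (R E : rel 'I_n.+1) :
  (n.+1 - m) * #|labelled Pi R E| <=
  \sum_(i < n.+1) #|labelled Pi (relpre (lift i) R) (relpre (lift i) E)|.
Proof.
pose G := labelled Pi R E.
apply: (@leq_trans (\sum_(i < n.+1) #|[set S in G | i \notin S]|)).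
  rewrite mulnC -sum_nat_const.
  under [leqRHS]eq_bigr do rewrite -sum1dep_card.
  rewrite [leqRHS](exchange_big_dep (mem G)) /=; last by move=> i S _; case/andP.
  apply: leq_sum => S SG; have /labelledP/labellable_card S_m := SG.
  have -> : n.+1 - m = #|~: S| by rewrite [RHS]cardsCs finset.setCK S_m card_ord.
  rewrite sum1dep_card subset_leq_card //; apply/fintype.subsetP=> i.
  by rewrite finset.in_setC finset.in_set SG.
apply: leq_sum => i _.
apply: leq_trans (leq_imset_card (fun T : {set 'I_n} => lift i @: T) _).
apply/subset_leq_card/fintype.subsetP => S.
rewrite finset.in_set => /andP[/labelledP SG iS].
have SE : S = lift i @: (lift i @^-1: S).
  apply/finset.setP=> j; apply/idP/imsetP => [jS|[k + ->]]; last by rewrite finset.inE.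
  case: (unliftP i j) jS iS => [k ->|->]; last by move=> ->.
  by exists k; rewrite ?finset.inE.
apply/imsetP; exists (lift i @^-1: S) => //; apply/labelledP.
by apply: labellable_relpre; [move=> ? ? _ _; apply: lift_inj | rewrite -SE].
Qed.

(** Adding a clone [None] of [i] keeps the old occurrences, and for each of those
    through [i] it creates a new one, in which the clone replaces [i].  Summing
    over [i], an occurrence is counted [#|I|] times as an old one and [m] times
    as the model of a new one. *)
Lemma labelled_clone l m (Pi : {set word l m}) (I : finType) (R E : rel I) :
  (#|I| + m) * #|labelled Pi R E| <=
  \sum_(i : I) #|labelled Pi (relpre (odflt i) R) (relpre (odflt i) E)|.
Proof.
pose G := labelled Pi R E.
apply: (@leq_trans (\sum_(i : I) (#|G| + #|[set S in G | i \in S]|))).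
  rewrite big_split /= sum_nat_const mulnDl leq_add2l mulnC -sum_nat_const.
  under [leqRHS]eq_bigr do rewrite -sum1dep_card.
  rewrite [leqRHS](exchange_big_dep (mem G)) /=; last by move=> i S _; case/andP.
  apply: leq_sum => S SG; have /labelledP/labellable_card S_m := SG.
  rewrite sum1dep_card -S_m.
  by rewrite subset_leq_card //; apply/fintype.subsetP=> i; rewrite finset.in_set SG.
apply: leq_sum => i _.
pose c j := if j == i then None else Some j.
have cK : cancel c (odflt i) by move=> j; rewrite /c; case: eqP.
have c_inj := can_inj cK.
have some_inj : injective (@Some I) by move=> x y [].
rewrite -(card_imset _ (imset_inj some_inj)).
rewrite -(card_imset [set S in G | i \in S] (imset_inj c_inj)) -cardsUI.
set A := imset _ _; set B := imset _ _.
have -> : A :&: B = finset.set0.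
  apply/finset.setP=> U; rewrite !finset.inE.
  apply/andP => -[/imsetP[S _ ->] /imsetP[T + SE]].
  rewrite finset.inE => /andP[_ iT].
  have : None \in c @: T by apply/imsetP; exists i; rewrite /c ?eqxx.
  by rewrite -SE => /imsetP[].
rewrite cards0 addn0; apply/subset_leq_card/fintype.subsetP => U.
case/finset.setUP => /imsetP[S + ->].
  move=> /labelledP SL; apply/labelledP.
  by apply: labellable_imset SL => // ? ? _ _; apply: some_inj.
rewrite finset.in_set => /andP[/labelledP SL _]; apply/labelledP.
apply: labellable_imset SL => [? ? _ _|x y _ _|x y _ _]; first exact: c_inj.
  by rewrite /= !cK.
by rewrite /= !cK.
Qed.

(** * Symmetrization *)

(** Composing the relations with [merge x y] turns [y] into a clone of [x]. *)
Definition merge (I : finType) (x y z : I) : I := if z == y then x else z.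

(** Two points of [S] related by [E] cannot be ordered by [R], so they carry the
    same label; hence turning [y] into a clone of [x] keeps the labelling valid. *)
Lemma labellable_merge_both l m (Pi : {set word l m}) (I : finType)
    (R E : rel I) (x y : I) (S : {set I}) :
    reflexive E -> symmetric E -> (forall i j, E i j -> ~~ R i j) ->
    E x y -> x \in S -> labellable Pi R E S ->
  labellable Pi (relpre (merge x y) R) (relpre (merge x y) E) S.
Proof.
move=> Erefl Esym ER Exy xS [pi piP [h [h_pi h_lab]]].
have mS z : z \in S -> merge x y z \in S by rewrite /merge; case: eqP.
have hm z : z \in S -> h (merge x y z) = h z.
  rewrite /merge; case: eqP => // -> yS; apply/eqP; rewrite eqn_leq.
  apply/andP; split; rewrite leqNgt; apply/negP.
    by move=> /(h_lab _ _ yS xS).1; apply/negP/ER; rewrite Esym.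
  by move=> /(h_lab _ _ xS yS).1; apply/negP/ER.
exists pi => //; exists h; split=> // i j iS jS /=.
by rewrite -(hm i iS) -(hm j jS); apply: h_lab; apply: mS.
Qed.

(** If [y] is not used, the clone of [x] changes nothing on [S], and it may also
    take the place of [x]. *)
Lemma labellable_merge_out l m (Pi : {set word l m}) (I : finType)
    (R E : rel I) (x y : I) (S : {set I}) :
    y \notin S -> labellable Pi R E S ->
  labellable Pi (relpre (merge x y) R) (relpre (merge x y) E) S /\
  labellable Pi (relpre (merge x y) R) (relpre (merge x y) E) (tperm x y @: S).
Proof.
move=> yS SL; have mS z : z \in S -> merge x y z = z.
  by rewrite /merge; case: eqP => // ->; rewrite (negPf yS).
have mtS z : z \in S -> merge x y (tperm x y z) = z.
  rewrite /merge; case: tpermP => [->|->|/eqP zx /eqP zy]; rewrite ?eqxx //.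
    by rewrite (negPf yS).
  by rewrite (negPf zy).
split; last first.
  apply: labellable_imset SL => [? ? _ _|i j iS jS|i j iS jS] /=.
  - exact: perm_inj.
  - by rewrite !mtS.
  - by rewrite !mtS.
rewrite -[S]imset_id; apply: labellable_imset SL => // i j iS jS /=;
  by rewrite !mS.
Qed.

(** Symmetrization step.  Occurrences through neither or both of [x] and [y]
    survive in both modifications.  Those through [x] only are doubled when [y]
    becomes a clone of [x] and lost in the other modification, and conversely.
    So the number of occurrences is at most the mean of the two new numbers.
    Pairing each [S] with its image under the exchange of [x] and [y] makes the
    inequality hold term by term. *)
Lemma labelled_merge l m (Pi : {set word l m}) (I : finType) (R E : rel I)
    (x y : I) :
    reflexive E -> symmetric E -> (forall i j, E i j -> ~~ R i j) -> E x y ->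
  2 * #|labelled Pi R E| <=
  #|labelled Pi (relpre (merge x y) R) (relpre (merge x y) E)| +
  #|labelled Pi (relpre (merge y x) R) (relpre (merge y x) E)|.
Proof.
move=> Erefl Esym ER Exy; pose t (S : {set I}) := tperm x y @: S.
have tK : involutive t.
  move=> S; rewrite /t -imset_comp -[RHS]imset_id; apply: eq_imset => z /=.
  exact: tpermK.
have t_inj := inv_inj tK.
have in_t S z : (tperm x y z \in t S) = (z \in S) by apply: mem_imset perm_inj.
have xt S : (x \in t S) = (y \in S) by rewrite -(in_t S y) tpermR.
have yt S : (y \in t S) = (x \in S) by rewrite -(in_t S x) tpermL.
have double (A : {set {set I}}) : 2 * #|A| = \sum_S ((S \in A) + (t S \in A)).
  have AE : #|A| = \sum_S (S \in A) by rewrite -sum1_card [LHS]big_mkcond.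
  by rewrite big_split /= mul2n -addnn {1}AE AE (reindex_inj t_inj).
rewrite -(leq_pmul2l (isT : 0 < 2)) [in leqRHS]mulnDr !double -big_split /=.
rewrite big_distrr /=.
set A := labelled Pi R E.
set B := labelled Pi (relpre (merge x y) R) _.
set C := labelled Pi (relpre (merge y x) R) _.
apply: leq_sum => S _.
have both (U : {set I}) :
    [&& x \in U, y \in U & U \in A] ==> (U \in B) && (U \in C).
  apply/implyP => /and3P[xU yU /labelledP UL]; apply/andP; split.
    by apply/labelledP/labellable_merge_both.
  by apply/labelledP/labellable_merge_both; rewrite // Esym.
have yN (U : {set I}) : (y \notin U) && (U \in A) ==> (U \in B) && (t U \in B).
  apply/implyP => /andP[yU /labelledP UL]; apply/andP.
  by have [? ?] := labellable_merge_out x yU UL; split; apply/labelledP.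
have xN (U : {set I}) : (x \notin U) && (U \in A) ==> (U \in C) && (t U \in C).
  apply/implyP => /andP[xU /labelledP UL]; apply/andP.
  have [? ?] := labellable_merge_out y xU UL.
  by split; apply/labelledP; rewrite // /t tpermC.
move: (both S) (both (t S)) (yN S) (yN (t S)) (xN S) (xN (t S)).
rewrite tK !xt !yt.
move: (x \in S) (y \in S) (S \in A) (t S \in A).
move: (S \in B) (t S \in B) (S \in C) (t S \in C).
by do 8!case.
Qed.

(** Among the maps with the largest number of occurrences, choose one with the
    largest total rank of values.  By [labelled_merge] both modifications at an
    [E]-related pair keep the maximal count; if the two values differed, the one
    that copies the larger value would increase the total rank. *)
Lemma labelled_collapse l m (Pi : {set word l m}) (I T : finType)
    (R E : rel T) (f : I -> T) :
    reflexive E -> symmetric E -> (forall i j, E i j -> ~~ R i j) ->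
  exists2 g : I -> T, forall i j, E (g i) (g j) -> g i = g j &
    #|labelled Pi (relpre f R) (relpre f E)| <=
    #|labelled Pi (relpre g R) (relpre g E)|.
Proof.
move=> Erefl Esym ER.
(* [N] is maximised first; [W] chooses among the maximisers of [N]. *)
pose N (g : {ffun I -> T}) := #|labelled Pi (relpre g R) (relpre g E)|.
pose W (g : {ffun I -> T}) := \sum_i (enum_rank (g i) : nat).
have [g1 _ g1_max] := @arg_maxnP _ (finfun f) xpredT N isT.
have [g /eqP gN g_max] := @arg_maxnP _ g1 (fun g => N g == N g1) W (eqxx _).
have fN : #|labelled Pi (relpre f R) (relpre f E)| <= N (finfun f).
  by apply: (@leq_labelled _ _ _ _ _ id) => // i j /=; rewrite !ffunE.
exists g; last by apply: (leq_trans fN); rewrite -/(N g) gN; apply: g1_max.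
suff lt_false i j : E (g i) (g j) -> enum_rank (g i) < enum_rank (g j) -> False.
  move=> i j Eij.
  case: (ltngtP (enum_rank (g i) : nat) (enum_rank (g j))) => [lt_ij|lt_ji|eq_ij].
  - by case: (lt_false _ _ Eij lt_ij).
  - by rewrite Esym in Eij; case: (lt_false _ _ Eij lt_ji).
  - exact: enum_rank_inj (ord_inj eq_ij).
move=> Eij lt_ij; pose G x y : {ffun I -> T} := [ffun z => g (merge x y z)].
have GN x y : #|labelled Pi (relpre (merge x y) (relpre g R))
    (relpre (merge x y) (relpre g E))| <= N (G x y).
  by apply: (@leq_labelled _ _ _ _ _ id) => // a b /=; rewrite !ffunE.
have NG x y : N (G x y) <= N g by rewrite gN; apply: g1_max.
have : 2 * N g <= N (G j i) + N (G i j).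
  apply: (leq_trans (@labelled_merge _ _ _ _ _ _ j i _ _ _ _)).
  - by move=> z; apply: Erefl.
  - by move=> z z'; apply: Esym.
  - by move=> z z'; apply: ER.
  - by rewrite /= Esym.
  - by apply: leq_add; apply: GN.
rewrite mul2n -addnn => /leq_trans/(_ (leq_add (leqnn _) (NG i j))).
rewrite leq_add2r => NgG.
have /g_max : N (G j i) == N g1 by rewrite -gN eqn_leq NG.
rewrite /= leqNgt => /negP; apply; rewrite /W (bigD1 i) //= [ltnRHS](bigD1 i) //=.
rewrite ffunE /merge eqxx -addSn leq_add //; apply: leq_sum => z zi.
by rewrite ffunE /merge (negPf zi).
Qed.

(** * Occurrences in words *)

(** For [p] nondecreasing: [v] increases where [p] does, and is related by [e]
    along the constant runs of [p].  With [e] equality, [v] is order-isomorphic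
    to [p]; with [e] the relation [gtn], it is order-isomorphic to the layered
    permutation whose layers are the runs of [p]. *)
Definition fits (p : seq nat) (e : rel nat) (v : seq nat) : Prop :=
  size v = size p /\
  forall x y, x < y < size p ->
    (nth 0 p x < nth 0 p y -> nth 0 v x < nth 0 v y) /\
    (nth 0 p x = nth 0 p y -> e (nth 0 v x) (nth 0 v y)).

(** [e] is one of the possible outcomes of comparing two numbers. *)
Definition order_determined (e : rel nat) : Prop :=
  forall a b c d, e a b ->
    e c d = ((a < b) == (c < d)) && ((b < a) == (d < c)).

Lemma order_determined_eq : order_determined eq_op.
Proof. move=> a b c d /eqP ->; rewrite ltnn; case: (ltngtP c d) => _; reflexivity. Qed.

Lemma order_determined_gtn : order_determined gtn.
Proof.
move=> a b c d /= ba; have -> : (a < b) = false by rewrite ltnNge ltnW.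
by rewrite ba; case: (ltngtP c d) => _; reflexivity.
Qed.

Lemma order_isoP (u v : seq nat) :
  reflect (size u = size v /\ forall x y, x < size u -> y < size u ->
             (nth 0 u x < nth 0 u y) = (nth 0 v x < nth 0 v y))
          (order_iso u v).
Proof.
apply: (iffP andP) => -[].
  move=> /eqP sz /forallP H; split=> // x y xu yu.
  exact: (eqP (forallP (H (Ordinal xu)) (Ordinal yu))).
move=> sz H; rewrite sz eqxx; split=> //.
by apply/forallP=> x; apply/forallP => y; apply/eqP/H; rewrite sz.
Qed.

Lemma sorted_nth_leq (p : seq nat) x y :
  sorted leq p -> x <= y < size p -> nth 0 p x <= nth 0 p y.
Proof.
move=> p_s /andP[xy yp].
by apply: (sorted_leq_nth leq_trans leqnn); rewrite ?finset.inE // (leq_ltn_trans xy).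
Qed.

Lemma fits_order_iso (p w v : seq nat) (e : rel nat) :
  sorted leq p -> order_determined e -> fits p e w ->
  order_iso w v <-> fits p e v.
Proof.
move=> p_s eP [szw wP]; split.
  case/order_isoP => sz H; split=> [|x y xy]; first by rewrite -sz.
  have /andP[lt_xy yp] := xy; have xp := ltn_trans lt_xy yp.
  have [w1 w2] := wP x y xy; split=> [/w1|/w2 exy]; first by rewrite H ?szw.
  by rewrite (eP _ _ _ _ exy) !H ?szw // !eqxx.
case=> szv vP; apply/order_isoP; split=> [|x y xw yw]; first by rewrite szw.
rewrite szw in xw yw.
have main a b : a < b < size p ->
   (nth 0 w a < nth 0 w b) = (nth 0 v a < nth 0 v b) /\
   (nth 0 w b < nth 0 w a) = (nth 0 v b < nth 0 v a).
  move=> ab; have [w1 w2] := wP a b ab; have [v1 v2] := vP a b ab.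
  have /andP[lt_ab bp] := ab.
  have : nth 0 p a <= nth 0 p b by apply: sorted_nth_leq; rewrite ?(ltnW lt_ab).
  rewrite leq_eqVlt => /orP[/eqP pE|plt].
    have := v2 pE; rewrite (eP _ _ _ _ (w2 pE)).
    by case/andP => /eqP -> /eqP ->.
  have wlt := w1 plt; have vlt := v1 plt.
  by rewrite wlt vlt !ltnNge !(ltnW wlt) !(ltnW vlt).
case: (ltngtP x y) => [xy|yx|->]; last by rewrite !ltnn.
  by apply: (main x y _).1; rewrite xy.
by apply: (main y x _).2; rewrite yx.
Qed.

Definition word_lt n (w : 'I_n -> nat) : rel 'I_n :=
  fun i j => (i < j) && (w i < w j).

(** The reflexive and symmetric relation of two positions whose letters, read
    from left to right, are related by [e]. *)
Definition word_tie (e : rel nat) n (w : 'I_n -> nat) : rel 'I_n :=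
  fun i j => [|| i == j, (i < j) && e (w i) (w j) | (j < i) && e (w j) (w i)].

Lemma enum_ord_sorted n (S : {set 'I_n}) :
  sorted (fun i j : 'I_n => i < j) (enum S).
Proof.
rewrite -[sorted _ _](@sorted_map _ _ val ltn) /enum_mem -enumT.
apply: (subseq_sorted ltn_trans (map_subseq _ (filter_subseq _ _))).
by rewrite val_enum_ord iota_ltn_sorted.
Qed.

(** Listing the labels of [S] in the order of positions gives a nondecreasing
    sequence, because [word_lt] refines the order of positions; a nondecreasing
    rearrangement of [p] can only be [p] itself. *)
Lemma fits_labelling (p : seq nat) (e : rel nat) k n (sigma : word k n)
    (S : {set 'I_n}) : sorted leq p ->
  let w i := val (tnth sigma i) in
  fits p e (letters (subword sigma S)) <->
  exists h, labelling (word_lt w) (word_tie e w) p S h.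
Proof.
move=> p_s w; have -> : letters (subword sigma S) = [seq w i | i <- enum S].
  by rewrite /letters -map_comp.
have tr : transitive (fun i j : 'I_n => i < j) by move=> ? ? ?; apply: ltn_trans.
have idx i j : i \in enum S -> j \in enum S ->
    (i < j) = (index i (enum S) < index j (enum S)).
  move=> iS jS; apply/idP/idP => [|lt_ij]; last first.
    exact: (sorted_ltn_index tr (enum_ord_sorted S)).
  rewrite !ltnNge; apply: contra; rewrite leq_eqVlt => /orP[/eqP E|lt_ji].
    by rewrite -(nth_index i jS) E nth_index.
  by apply: ltnW; apply: (sorted_ltn_index tr (enum_ord_sorted S)).
split=> [[]|[h [h_p h_lab]]].
  rewrite size_map => sz fit; exists (fun i => nth 0 p (index i (enum S))).
  split.
    suff -> : [seq nth 0 p (index i (enum S)) | i <- enum S] = p by [].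
    apply: (@eq_from_nth _ 0); first by rewrite size_map.
    move=> x; rewrite size_map => xS.
    have [i0 _] : exists i0, i0 \in enum S.
      by case: (enum S) xS => // a s; exists a; rewrite mem_head.
    by rewrite (nth_map i0) // index_uniq ?enum_uniq.
  have lt_case i j : i \in enum S -> j \in enum S -> i < j ->
      (nth 0 p (index i (enum S)) < nth 0 p (index j (enum S)) -> w i < w j) /\
      (nth 0 p (index i (enum S)) = nth 0 p (index j (enum S)) -> e (w i) (w j)).
    move=> iS jS ij; have := fit (index i (enum S)) (index j (enum S)).
    rewrite -idx // ij -sz index_mem jS !(nth_map i) ?index_mem // !nth_index //.
    exact.
  move=> i j; rewrite -!(mem_enum S) => iS jS; split=> [lt_h|eq_h].
    rewrite /word_lt; case: (ltngtP i j) => [ij|ji|ij].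
    - by rewrite (lt_case i j iS jS ij).1.
    - move: lt_h; rewrite ltnNge sorted_nth_leq // -sz index_mem iS andbT.
      by apply: ltnW; rewrite -idx.
    - by rewrite (ord_inj ij) ltnn in lt_h.
  rewrite /word_tie -(inj_eq val_inj) /=.
  case: (ltngtP i j) => //= [ij|ji].
    by rewrite (lt_case i j iS jS ij).2.
  by rewrite (lt_case j i jS iS ji).2.
have hE : [seq h i | i <- enum S] = p.
  apply: (sorted_eq leq_trans anti_leq) h_p => //.
  rewrite sorted_map; apply: sub_in_sorted (enum_ord_sorted S) => //.
  move=> i j; rewrite !mem_enum => iS jS ij /=; rewrite leqNgt; apply/negP.
  by move=> /(h_lab _ _ jS iS).1/andP[]; rewrite ltnNge ltnW.
split; rewrite -hE !size_map // => x y /andP[xy yS]; have xS := ltn_trans xy yS.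
have [i0 _] : exists i0, i0 \in enum S.
  by case: (enum S) xS => // a s; exists a; rewrite mem_head.
rewrite !(nth_map i0) //; set i := nth _ _ x; set j := nth _ _ y.
have iS : i \in S by rewrite -mem_enum mem_nth.
have jS : j \in S by rewrite -mem_enum mem_nth.
have ij : i < j by rewrite idx ?mem_enum // !index_uniq ?enum_uniq.
have [h1 h2] := h_lab i j iS jS; split=> [/h1/andP[]//|/h2].
by rewrite /word_tie -(inj_eq val_inj) /= ij ltn_eqF //= ltnNge ltnW //= orbF.
Qed.

Lemma nu_labelled l m (Pi : {set word l m}) l' (Q : {set word l' m})
    (e : rel nat) k n (sigma : word k n) :
    {in Pi, forall pi : word l m, sorted leq (letters pi)} ->
    order_determined e ->
    {in Q, forall q : word l' m,
      exists2 pi, pi \in Pi & fits (letters pi) e (letters q)} ->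
    {in Pi, forall pi : word l m,
      exists2 q, q \in Q & fits (letters pi) e (letters q)} ->
  let w i := val (tnth sigma i) in
  nu Q sigma = #|labelled Pi (word_lt w) (word_tie e w)|.
Proof.
move=> Pi_s eP QPi PiQ w; congr #|pred_of_set _|; apply/finset.setP => S.
rewrite finset.in_set; apply/exists_inP/labelledP => [[q qQ iso]|[pi piP lab]].
  have [pi piP fq] := QPi q qQ; exists pi => //.
  apply/(fits_labelling e sigma S (Pi_s pi piP)).
  exact/(fits_order_iso _ (Pi_s pi piP) eP fq).
have [q qQ fq] := PiQ pi piP; exists q => //.
apply/(fits_order_iso _ (Pi_s pi piP) eP fq).
exact/(fits_labelling e sigma S (Pi_s pi piP)).
Qed.

Definition blocks (es : seq nat) (f : nat -> nat) : seq nat :=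
  flatten [seq nseq (f x) x | x <- es].

Lemma mem_blocks es f x : x \in blocks es f -> x \in es.
Proof. by case/flattenP => s /mapP[y ys ->] /nseqP[-> _]. Qed.

Lemma blocks_sorted es f : sorted leq es -> sorted leq (blocks es f).
Proof.
rewrite !sorted_pairwise; try exact: leq_trans.
elim: es => //= x es IH /andP[x_es /IH es_s].
rewrite /blocks /= pairwise_cat es_s andbT; apply/andP; split.
  by apply/allrelP => a b /nseqP[-> _] /mem_blocks/(allP x_es).
apply/(pairwiseP 0) => a b; rewrite !inE size_nseq => af bf _.
by rewrite !nth_nseq af bf.
Qed.

(** The layers of [w] are its restrictions to the runs of the nondecreasing
    sequence with the same run lengths. *)
Lemma has_layers_fits es f w :
  sorted ltn es -> has_layers [seq f x | x <- es] w -> fits (blocks es f) gtn w.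
Proof.
elim: es w => [|x es IH] w es_s /and4P[f_gt0 /eqP sz_w dec inc].
  by rewrite (size0nil (esym sz_w)); split=> // x y; rewrite andbC.
move: f_gt0 dec inc => /= /andP[_ f_gt0] /andP[dec_t dec_d] /andP[inc_t inc_d].
set t := take _ w in dec_t inc_t; set d := drop _ w in dec_d inc_d inc_t.
have sz_t : size t = f x by rewrite size_takel // -sz_w leq_addr.
have sz_d : sumn (map f es) = size d by rewrite size_drop -sz_w /= addKn.
have lt_td : allrel ltn t d.
  rewrite -(@reshapeKr _ (map f es) d) -?sz_d //; apply/allrelP => i j i_t.
  by case/flattenP => B /(allP inc_t) /allrelP; apply.
have [szd dfit] : fits (blocks es f) gtn d.
  apply: IH; first exact: path_sorted es_s.
  by rewrite /has_layers f_gt0 sz_d eqxx dec_d inc_d.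
have w_td : w = t ++ d by rewrite cat_take_drop.
rewrite w_td /blocks /= -/(blocks es f); split.
  by rewrite !size_cat sz_t szd size_nseq.
move=> a b; rewrite size_cat size_nseq !nth_cat size_nseq sz_t !nth_nseq.
case/andP=> ab bsz; case: (ltnP b (f x)) => bf.
  rewrite (ltn_trans ab bf) ltnn; split=> // _.
  have gtn_trans : transitive gtn by move=> u v z vu uz; apply: ltn_trans uz vu.
  apply: (sorted_ltn_nth gtn_trans _ dec_t); rewrite ?finset.inE ?sz_t //.
  exact: ltn_trans ab bf.
have bd : b - f x < size (blocks es f) by rewrite ltn_subLR.
case: (ltnP a (f x)) => af; last by apply: dfit; rewrite ltn_sub2r ?(leq_ltn_trans af).
have lt_x : x < nth 0 (blocks es f) (b - f x).
  move: es_s; rewrite /= path_sortedE; last exact: ltn_trans.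
  by case/andP => /allP/(_ _ (mem_blocks (mem_nth 0 bd))).
split=> [_|E]; last by rewrite -E ltnn in lt_x.
by apply: (allrelP lt_td); apply: mem_nth; rewrite ?sz_t ?szd.
Qed.

(** * Maximal numbers of occurrences *)

Definition max_word l m (Q : {set word l m}) k n : nat :=
  \max_(sigma : word k n) nu Q sigma.

Definition max_layered m (A : {set 'S_m}) k n : nat :=
  \max_(s : 'S_n | `[< layered_at_most k s >])
    nu (words_of_perms A) (word_of_perm s).

Lemma nth_letters k n (w : word k n) (i : 'I_n) :
  nth 0 (letters w) i = val (tnth w i).
Proof.
by rewrite /letters (nth_map (tnth w i)) ?size_tuple ?ltn_ord // -tnth_nth.
Qed.

Lemma nondecreasing_blocks l m (pi : word l m) :
  nondecreasing_pattern pi ->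
  let f c := count_mem c (letters pi) in
  letters pi = blocks (iota 0 l) f /\ mults pi = [seq f c | c <- iota 0 l].
Proof.
case/andP=> _ /eqP pi_flat f.
have fE (i : 'I_l) : f i = count_mem i pi.
  by rewrite /f /letters count_map; apply: eq_count => j /=; rewrite (inj_eq val_inj).
split; last by rewrite -val_enum_ord -map_comp; apply: eq_map => i /=; rewrite fE.
rewrite {1}/letters {1}pi_flat map_flatten -map_comp /blocks -val_enum_ord -map_comp.
by congr flatten; apply: eq_map => i /=; rewrite map_nseq fE.
Qed.

Lemma nondecreasing_sorted l m (pi : word l m) :
  nondecreasing_pattern pi -> sorted leq (letters pi).
Proof.
by case/nondecreasing_blocks => -> _; apply: blocks_sorted; apply: iota_sorted.
Qed.

Lemma nu_nondecreasing l m (Pi : {set word l m}) k n (sigma : word k n) :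
    (forall pi, pi \in Pi -> nondecreasing_pattern pi) ->
  let w i := val (tnth sigma i) in
  nu Pi sigma = #|labelled Pi (word_lt w) (word_tie eq_op w)|.
Proof.
move=> HPi; have self pi : pi \in Pi -> fits (letters pi) eq_op (letters pi).
  by move=> _; split=> // x y _; split=> // ->.
apply: nu_labelled => [pi /HPi/nondecreasing_sorted //||pi piP|pi piP].
- exact: order_determined_eq.
- by exists pi => //; apply: self.
- by exists pi => //; apply: self.
Qed.

Lemma nu_hat l m (Pi : {set word l m}) k n (sigma : word k n) :
    (forall pi, pi \in Pi -> nondecreasing_pattern pi) ->
  let w i := val (tnth sigma i) in
  nu (words_of_perms (hat Pi)) sigma =
  #|labelled Pi (word_lt w) (word_tie gtn w)|.
Proof.
move=> HPi; have hat_fits (pi : word l m) (s : 'S_m) : pi \in Pi ->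
    perm_has_layers (mults pi) s ->
    fits (letters pi) gtn (letters (word_of_perm s)).
  move=> /HPi/nondecreasing_blocks[piE multsE]; rewrite multsE [X in fits X]piE.
  by apply: has_layers_fits; apply: iota_ltn_sorted.
apply: nu_labelled => [pi /HPi/nondecreasing_sorted //||q|pi piP].
- exact: order_determined_gtn.
- case/imsetP => s; rewrite finset.in_set => /exists_inP[pi piP s_pi] ->.
  by exists pi => //; apply: hat_fits.
have /andP[mults_gt0 _] := HPi pi piP.
have [s [s_pi _]] := layered_perm_unique mults_gt0 (sumn_mults (HPi pi piP)).
exists (word_of_perm s); last exact: hat_fits.
by apply: imset_f; rewrite finset.in_set; apply/exists_inP; exists pi.
Qed.

Lemma perm_eq_reindex (u v : seq nat) : perm_eq u v ->
  exists rho : 'S_(size u), forall i : 'I_(size u), nth 0 u i = nth 0 v (rho i).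
Proof.
move=> uv; have sz : size v == size u by rewrite eq_sym (perm_size uv).
have /tuple_permP[rho uE] : perm_eq (in_tuple u) (Tuple sz) by [].
exists rho => i; rewrite {1}(uE : u = _) (nth_map i) ?size_enum_ord //.
by rewrite nth_ord_enum (tnth_nth 0).
Qed.

(** The points of [I], with labels compared through [f] only, embed into the
    layered permutation whose layers are the nonempty fibres of [f] in increasing
    order: any bijection that sends fibres onto layers will do. *)
Lemma labelled_le_layered l m (Pi : {set word l m}) (I : finType) k
    (f : I -> 'I_k) : (forall pi, pi \in Pi -> nondecreasing_pattern pi) ->
  #|labelled Pi (fun i j => f i < f j) (fun i j => f i == f j)| <=
  max_layered (hat Pi) k #|I|.
Proof.
move=> HPi; pose u := [seq val (f i) | i <- enum I].
have sz_u : size u = #|I| by rewrite size_map -cardE.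
pose es := sort leq (undup u); pose g x := count_mem x u.
have es_s : sorted ltn es.
  by rewrite ltn_sorted_uniq_leq sort_uniq undup_uniq sort_sorted //; apply: leq_total.
have u_perm : perm_eq u (blocks es g).
  rewrite perm_sym; apply: perm_trans (perm_count_undup u).
  by apply/perm_flatten/perm_map; rewrite perm_sort.
have a_gt0 : all (leq 1) (map g es).
  rewrite all_map; apply/allP => x; rewrite mem_sort mem_undup.
  by rewrite -has_pred1 has_count.
have a_sum : sumn (map g es) = #|I|.
  rewrite -sz_u (perm_size u_perm) size_flatten /shape -map_comp.
  by congr sumn; apply: eq_map => x /=; rewrite size_nseq.
have [s [s_lay _]] := layered_perm_unique a_gt0 a_sum.
have s_k : layered_at_most k s.
  exists (map g es) => //; rewrite size_map size_sort -[k]card_ord cardE.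
  rewrite -(size_map val); apply: uniq_leq_size; first exact: undup_uniq.
  by move=> x; rewrite mem_undup => /mapP[i _ ->]; rewrite map_f ?mem_enum.
have [sz_s s_fit] := has_layers_fits es_s s_lay.
have [rho rhoE] := perm_eq_reindex u_perm; rewrite sz_u in rho rhoE.
pose r i := rho (enum_rank i); pose b (x : 'I_#|I|) := nth 0 (blocks es g) x.
have fr i : val (f i) = b (r i).
  rewrite /b -rhoE /u (nth_map i) -?cardE ?ltn_ord //.
  by rewrite nth_enum_rank.
apply: (@leq_trans (nu (words_of_perms (hat Pi)) (word_of_perm s))); last first.
  by apply: leq_bigmax_cond; apply: asboolT.
rewrite (nu_hat _ HPi); pose w x := val (tnth (word_of_perm s) x); rewrite -/w.
have wE (x : 'I_ _) : w x = nth 0 (letters (word_of_perm s)) x.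
  by rewrite nth_letters.
have sz_b : size (blocks es g) = #|I| by rewrite -(perm_size u_perm).
have b_s (x y : 'I_#|I|) : x <= y -> b x <= b y.
  move=> xy; apply: sorted_nth_leq; last by rewrite xy sz_b ltn_ord.
  by apply: blocks_sorted; apply: sub_sorted es_s => ? ?; apply: ltnW.
have b_w (x y : 'I_#|I|) : x < y ->
    (b x < b y -> w x < w y) /\ (b x = b y -> w y < w x).
  by move=> xy; rewrite !wE; apply: s_fit; rewrite xy sz_b ltn_ord.
apply: (@leq_labelled _ _ _ _ _ r) => [|i j|i j].
- by move=> i j /perm_inj/enum_rank_inj.
- rewrite !fr => lt_b; have lt_r : r i < r j.
    by rewrite ltnNge; apply: contraL lt_b => /b_s; rewrite -leqNgt.
  by rewrite /word_lt lt_r /= (b_w _ _ lt_r).1.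
move=> /eqP fij; have eq_b : b (r i) = b (r j) by rewrite -!fr fij.
rewrite /word_tie -(inj_eq val_inj) /=; case: ltngtP => //= lt_r.
  by rewrite (b_w _ _ lt_r).2.
by rewrite (b_w _ _ lt_r).2.
Qed.

(** Replacing each entry of a layered permutation by the index of its layer turns
    inversions into equalities of letters. *)
Lemma max_layered_le_word l m (Pi : {set word l m}) k n :
    (forall pi, pi \in Pi -> nondecreasing_pattern pi) ->
  max_layered (hat Pi) k n <= max_word Pi k n.
Proof.
move=> HPi; apply/bigmax_leqP => s /asboolP[a a_k s_lay].
have aE : a = [seq nth 0 a x | x <- iota 0 (size a)] by rewrite [RHS]mkseq_nth.
move: s_lay; rewrite /perm_has_layers aE.
move=> /(has_layers_fits (iota_ltn_sorted 0 (size a))).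
set b := blocks _ _; case=> sz_s s_fit.
have sz_b : size b = n by rewrite -sz_s size_map size_tuple.
have b_k (x : 'I_n) : nth 0 b x < k.
  apply: leq_trans a_k; have := mem_nth 0 (_ : x < size b).
  by rewrite sz_b ltn_ord => /(_ isT)/mem_blocks; rewrite mem_iota.
pose tau : word k n := [tuple Ordinal (b_k x) | x < n].
apply: (@leq_trans (nu Pi tau)); last exact: leq_bigmax.
rewrite (nu_nondecreasing _ HPi) (nu_hat _ HPi).
pose w x := val (tnth (word_of_perm s) x); pose v x := val (tnth tau x).
rewrite -/w -/v.
have wE (x : 'I_ _) : w x = nth 0 (letters (word_of_perm s)) x.
  by rewrite nth_letters.
have vE x : v x = nth 0 b x by rewrite /v tnth_mktuple.
have v_w (x y : 'I_n) : x < y ->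
    (v x < v y -> w x < w y) /\ (v x = v y -> w y < w x).
  by move=> xy; rewrite !wE !vE; apply: s_fit; rewrite xy sz_b ltn_ord.
have v_s (x y : 'I_n) : x < y -> v x <= v y.
  move=> xy; rewrite !vE; apply: sorted_nth_leq; last by rewrite ltnW // sz_b ltn_ord.
  by apply: blocks_sorted; apply: iota_sorted.
have lt_v (x y : 'I_n) : x < y -> w x < w y -> v x < v y.
  move=> xy lt_w; rewrite ltn_neqAle v_s // andbT; apply/eqP => eq_v.
  by have := (v_w _ _ xy).2 eq_v; rewrite ltnNge ltnW.
have eq_v (x y : 'I_n) : x < y -> w y < w x -> v x == v y.
  move=> xy lt_w; rewrite eqn_leq v_s //= leqNgt; apply/negP => lt_v'.
  by have := (v_w _ _ xy).1 lt_v'; rewrite ltnNge ltnW.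
apply: (@leq_labelled _ _ _ _ _ id) => // i j.
  by case/andP => ij /(lt_v _ _ ij) lt_vij; rewrite /word_lt ij.
rewrite /word_tie => /or3P[->//|/andP[ij /(eq_v _ _ ij) ->]|/andP[ij /(eq_v _ _ ij) ->]].
  by rewrite ij orbT.
by rewrite ij !orbT.
Qed.

Lemma nu_le_labelled l m (Pi : {set word l m}) k n (sigma : word k n) :
    (forall pi, pi \in Pi -> nondecreasing_pattern pi) ->
  nu Pi sigma <=
  #|labelled Pi (fun i j => tnth sigma i < tnth sigma j)
                (fun i j => tnth sigma i == tnth sigma j)|.
Proof.
move=> HPi; rewrite (nu_nondecreasing _ HPi).
apply: (@leq_labelled _ _ _ _ _ id) => // i j; first by case/andP.
case/or3P => [/eqP-> //|/andP[_ /eqP/val_inj->]|/andP[_ /eqP/val_inj->]];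
  by rewrite eqxx.
Qed.

Lemma max_word_layered l m (Pi : {set word l m}) k n :
    (forall pi, pi \in Pi -> nondecreasing_pattern pi) ->
  max_word Pi k n = max_layered (hat Pi) k n.
Proof.
move=> HPi; apply/eqP; rewrite eqn_leq max_layered_le_word // andbT.
apply/bigmax_leqP => sigma _; apply: leq_trans (nu_le_labelled _ HPi) _.
by have := labelled_le_layered (tnth sigma) HPi; rewrite card_ord.
Qed.

(** After the collapse, the point [g i] serves as the letter of [i], which is why
    an alphabet of size [n] suffices. *)
Lemma max_word_hat_le l m (Pi : {set word l m}) k n :
    (forall pi, pi \in Pi -> nondecreasing_pattern pi) ->
  max_word (words_of_perms (hat Pi)) k n <= max_word Pi n n.
Proof.
move=> HPi; apply/bigmax_leqP => sigma _; rewrite (nu_hat _ HPi).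
pose w i := val (tnth sigma i); rewrite -/w.
have [|||g g_inj] := @labelled_collapse _ _ Pi _ _ (word_lt w) (word_tie gtn w) (@id 'I_n).
- by move=> i; rewrite /word_tie eqxx.
- by move=> i j; rewrite /word_tie eq_sym; congr orb; rewrite orbC.
- move=> i j; rewrite /word_tie /word_lt => /or3P[/eqP->|/andP[_ ji]|/andP[ji _]].
  + by rewrite ltnn.
  + by rewrite negb_and -!leqNgt orbC ltnW.
  + by rewrite negb_and -!leqNgt ltnW.
move=> /leq_trans; apply; rewrite max_word_layered //.
have := labelled_le_layered g HPi; rewrite card_ord; apply: leq_trans.
apply: (@leq_labelled _ _ _ _ _ id) => // i j /=; first by case/andP.
by move=> /g_inj ->.
Qed.

Lemma max_layered_le_hat l m (Pi : {set word l m}) k n :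
  max_layered (hat Pi) k n <= max_word (words_of_perms (hat Pi)) n n.
Proof. by apply/bigmax_leqP => s _; apply: leq_bigmax. Qed.

Lemma max_word_hat l m (Pi : {set word l m}) n :
    (forall pi, pi \in Pi -> nondecreasing_pattern pi) ->
  max_word (words_of_perms (hat Pi)) n n = max_word Pi n n.
Proof.
move=> HPi; apply/eqP; rewrite eqn_leq max_word_hat_le //=.
by rewrite (max_word_layered _ _ HPi) max_layered_le_hat.
Qed.

(** A layered permutation of length [n] is itself a word over [n] letters. *)
Lemma max_word_alphabet l m (Pi : {set word l m}) k n :
    (forall pi, pi \in Pi -> nondecreasing_pattern pi) ->
  max_word Pi k n <= max_word Pi n n.
Proof.
move=> HPi; rewrite (max_word_layered _ _ HPi) -(max_word_hat _ HPi).
exact: max_layered_le_hat.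
Qed.

Lemma max_word_attained l m (Q : {set word l m}) k n :
  max_word Q k n = 0 \/ exists sigma : word k n, max_word Q k n = nu Q sigma.
Proof.
case: (pickP (@predT (word k n))) => [sigma _|none].
  have [|tau tauE] := @bigop.eq_bigmax _ (nu Q : word k n -> nat).
    by apply/card_gt0P; exists sigma.
  by right; exists tau.
by left; apply: big1 => sigma _; have := none sigma.
Qed.

Lemma max_word_delete l m (Pi : {set word l m}) k n :
    (forall pi, pi \in Pi -> nondecreasing_pattern pi) ->
  (n.+1 - m) * max_word Pi k n.+1 <= n.+1 * max_word Pi k n.
Proof.
move=> HPi; have [->|[sigma ->]] := max_word_attained Pi k n.+1.
  by rewrite muln0.
apply: leq_trans (leq_mul (leqnn _) (nu_le_labelled sigma HPi)) _.
apply: leq_trans (labelled_delete _ _ _) _.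
rewrite -[X in X * max_word _ _ _]card_ord -sum_nat_const; apply: leq_sum => i _.
rewrite (max_word_layered _ _ HPi).
by have := labelled_le_layered (fun j => tnth sigma (lift i j)) HPi; rewrite card_ord.
Qed.

Lemma max_word_clone l m (Pi : {set word l m}) k n :
    (forall pi, pi \in Pi -> nondecreasing_pattern pi) ->
  (n + m) * max_word Pi k n <= n * max_word Pi k n.+1.
Proof.
move=> HPi; have [->|[sigma ->]] := max_word_attained Pi k n.
  by rewrite muln0.
apply: leq_trans (leq_mul (leqnn _) (nu_le_labelled sigma HPi)) _.
rewrite -[X in X + m]card_ord; apply: leq_trans (labelled_clone _ _ _) _.
rewrite -[X in X * max_word _ _ _]card_ord -sum_nat_const; apply: leq_sum => i _.
rewrite (max_word_layered _ _ HPi).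
have := labelled_le_layered (fun j => tnth sigma (odflt i j)) HPi.
by rewrite card_option card_ord.
Qed.

(** * Limits of densities *)

(** The rising factorial [n (n + 1) ... (n + m - 1)]. *)
Definition rising m n : nat := \prod_(i < m) (n + i).

Lemma rising_gt0 m n : 0 < n -> 0 < rising m n.
Proof. by move=> n_gt0; apply: prodn_gt0 => i; rewrite addn_gt0 n_gt0. Qed.

Lemma risingS m n : n * rising m n.+1 = (n + m) * rising m n.
Proof.
transitivity (\prod_(i < m.+1) (n + i)); last by rewrite big_ord_recr mulnC.
by rewrite big_ord_recl addn0; congr muln; apply: eq_bigr => i _; rewrite addSnnS.
Qed.

Lemma ffact_le_rising m n : n ^_ m <= rising m n.
Proof.
rewrite ffact_prod; apply: leq_prod => i _.
exact: leq_trans (leq_subr _ _) (leq_addr _ _).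
Qed.

Lemma clone_iter m (u : nat -> nat) n N :
    (forall j, (j + m) * u j <= j * u j.+1) -> 0 < n -> n <= N ->
  u n * rising m N <= u N * rising m n.
Proof.
move=> u_clone n_gt0 /subnKC <-; elim: (N - n) => [|j IH]; first by rewrite addn0.
have nj_gt0 : 0 < n + j by rewrite addn_gt0 n_gt0.
rewrite addnS -(leq_pmul2l nj_gt0) mulnCA risingS mulnCA.
apply: leq_trans (leq_mul (leqnn _) IH) _; rewrite !mulnA leq_mul2r.
by rewrite u_clone orbT.
Qed.

Local Open Scope ring_scope.
Local Open Scope classical_set_scope.

(** The hypothesis says that the quotient is nonincreasing from rank [m] on. *)
Lemma packing_is_cvg (R : realType) m (u : nat -> nat) :
    (forall n, (n.+1 - m) * u n.+1 <= n.+1 * u n)%N ->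
  cvgn (fun n => (u n)%:R / 'C(n, m)%:R : R).
Proof.
move=> u_del; set d := fun n => _.
suff : cvgn [sequence d (n + m)%N]_n.
  by case/cvg_ex => /= L; rewrite cvg_shiftn => dL; apply/cvg_ex; exists L.
apply: nonincreasing_is_cvgn; last first.
  by exists 0 => _ [n _ <-]; rewrite /d divr_ge0.
apply/nonincreasing_seqP => n; rewrite /d /= addSn; set N := (n + m)%N.
have mN : (m <= N)%N by rewrite leq_addl.
rewrite ler_pdivrMr ?ltr0n ?bin_gt0 ?(leqW mN) // mulrAC.
rewrite ler_pdivlMr ?ltr0n ?bin_gt0 // -!natrM ler_nat.
have binS : (N.+1 * 'C(N, m) = (N.+1 - m) * 'C(N.+1, m))%N.
  exact: mul_bin_down N.+1 m.
rewrite -(@leq_pmul2l (N.+1 - m)) ?subn_gt0 ?ltnS //.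
rewrite mulnA [leqRHS]mulnCA -binS [leqRHS]mulnA leq_mul2r.
by rewrite [X in (_ <= X)%N]mulnC u_del orbT.
Qed.

(** Each of the [m] factors [(n - i) / (n + i)] tends to 1. *)
Lemma cvg_ffact_rising (R : realType) m :
  (fun n => (n ^_ m)%:R / (rising m n)%:R : R) @ \oo --> (1 : R).
Proof.
under eq_fun => n do rewrite ffact_prod /rising !natr_prod -prodf_div.
elim: m => [|m IH].
  by under eq_fun => n do rewrite big_ord0; apply: cvg_cst.
under eq_fun => n do rewrite big_ord_recr /=.
suff factor_cvg : (fun n => (n - m)%:R / (n + m)%:R : R) @ \oo --> (1 : R).
  by have := cvgM IH factor_cvg; rewrite mulr1; apply.
rewrite -(cvg_shiftn 1).
apply: (@squeeze_cvgr _ _ _ _ (fun n => 1 - (m + m)%:R * harmonic n) (fun=> 1)).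
- near=> n; rewrite /= addn1; apply/andP; split; last first.
    rewrite ler_pdivrMr ?ltr0n // mul1r ler_nat.
    exact: leq_trans (leq_subr _ _) (leq_addr _ _).
  rewrite ler_pdivlMr ?ltr0n //.
  apply: (@le_trans _ _ (n.+1%:R - m%:R)); last first.
    by rewrite lerBlDr -natrD ler_nat addnC -leq_subLR.
  have mE : (m + m)%:R = m%:R + m%:R :> R by rewrite natrD.
  have sE : (n.+1 + m)%:R = n.+1%:R + m%:R :> R by rewrite natrD.
  have : (m + m)%:R <= (m + m)%:R * (n.+1%:R^-1) * (n.+1 + m)%:R :> R.
    by rewrite -mulrA ler_peMr // mulrC ler_pdivlMr ?ltr0n // mul1r ler_nat leq_addr.
  by rewrite mulrBl mul1r; set z := _ * _ * _; lra.
- have h0 : (fun n => (m + m)%:R * harmonic n : R) @ \oo --> (0 : R).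
    have /(@cvgMl_tmp _ _ _ _ _ (m + m)%:R) := @cvg_harmonic R.
    by rewrite mulr0; apply.
  by have := cvgB (cvg_cst (1 : R)) h0; rewrite subr0; apply.
- exact: cvg_cst.
Unshelve. all: by end_near. Qed.

(** [clone_iter] with the rising factorial of [N] replaced by the falling one,
    which is smaller; the second factor on the left is what this costs. *)
Lemma clone_density_le (R : realType) m (u : nat -> nat) n N :
    (forall j, (j + m) * u j <= j * u j.+1)%N ->
    (0 < n)%N -> (m <= n)%N -> (n <= N)%N ->
  (u n)%:R / 'C(n, m)%:R * ((n ^_ m)%:R / (rising m n)%:R) <=
  (u N)%:R / 'C(N, m)%:R :> R.
Proof.
move=> u_clone n_gt0 mn nN; have mN := leq_trans mn nN.
have Cn : 'C(n, m)%:R != 0 :> R by rewrite pnatr_eq0 -lt0n bin_gt0.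
rewrite -bin_ffact natrM mulrA -(mulrA _ _ (_%:R * _)) mulKf //.
rewrite ler_pdivrMr ?ltr0n ?rising_gt0 // mulrAC ler_pdivlMr ?ltr0n ?bin_gt0 //.
rewrite -!natrM ler_nat; apply: leq_trans (clone_iter u_clone n_gt0 nN).
by rewrite -mulnA leq_mul2l (mulnC m`!) bin_ffact ffact_le_rising orbT.
Qed.

(** The limit for the alphabet [k] is at least the diagonal density at [k] up to
    the factor of [cvg_ffact_rising], by [clone_density_le], and at most the
    limit of the diagonal densities. *)
Lemma diagonal_limit (R : realType) m (u : nat -> nat -> nat) :
    (forall k n, (n.+1 - m) * u k n.+1 <= n.+1 * u k n)%N ->
    (forall k n, (n + m) * u k n <= n * u k n.+1)%N ->
    (forall k n, u k n <= u n n)%N ->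
  let d k n : R := (u k n)%:R / 'C(n, m)%:R in
  cvgn (fun n => d n n) /\
  (fun k => limn (fun n => d k n)) @ \oo --> limn (fun n => d n n).
Proof.
move=> u_del u_clone u_diag d.
have d_cvg k : cvgn (d k) by apply: packing_is_cvg.
have dd_cvg : cvgn (fun n => d n n).
  apply: (@packing_is_cvg R m (fun n => u n n)) => n.
  by apply: leq_trans (u_del _ _) _; rewrite leq_mul2l u_diag orbT.
split=> //; apply: (@squeeze_cvgr _ _ _ _
  (fun n => d n n * ((n ^_ m)%:R / (rising m n)%:R)) (fun=> limn (fun n => d n n))).
- near=> k; apply/andP; split.
    apply: limr_ge => //; near=> n; apply: clone_density_le => //; last first.
    + by near: n; apply: nbhs_infty_ge.
    + by near: k; apply: nbhs_infty_ge.
    + by near: k; apply: nbhs_infty_gt.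
  apply: ler_lim => //; near=> n; rewrite ler_pM2r.
    by rewrite ler_nat.
  by rewrite invr_gt0 ltr0n bin_gt0; near: n; apply: nbhs_infty_ge.
- by have := cvgM dd_cvg (@cvg_ffact_rising R m); rewrite mulr1; apply.
- exact: cvg_cst.
Unshelve. all: by end_near. Qed.

Theorem theorem2p1 (R : realType) (l m : nat) (Pi : {set word l m})
    (HPi : forall pi, pi \in Pi -> nondecreasing_pattern pi) :
  (forall k : nat, (1 <= k)%N ->
     [/\ cvgn (fun n => density R Pi k n),
         cvgn (fun n => layer_density R (hat Pi) k n)
       & delta_alphabet R Pi k = delta_layer R (hat Pi) k]) /\
  [/\ cvgn (fun k => delta_alphabet R Pi k),
      cvgn (fun n => density R Pi n n),
      cvgn (fun n => density R (words_of_perms (hat Pi)) n n),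
      delta_prime R Pi = delta R Pi
    & delta R Pi = delta R (words_of_perms (hat Pi))].
Proof.
have layerE k : (fun n => layer_density R (hat Pi) k n) = (fun n => density R Pi k n).
  apply/funext => n; rewrite /layer_density -/(max_layered (hat Pi) k n).
  by rewrite -max_word_layered.
have hatE : (fun n => density R (words_of_perms (hat Pi)) n n) =
    (fun n => density R Pi n n).
  apply/funext => n; rewrite /density -/(max_word (words_of_perms (hat Pi)) n n).
  by rewrite max_word_hat.
have del k n := max_word_delete k n HPi.
have clone k n := max_word_clone k n HPi.
have alphabet k n := max_word_alphabet k n HPi.
have [diag_cvg prime_cvg] := diagonal_limit R del clone alphabet.
split=> [k _|].
  have k_cvg : cvgn (fun n => density R Pi k n) := @packing_is_cvg R m _ (del k).
  by rewrite /delta_alphabet /delta_layer layerE.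
split.
- by apply/cvg_ex; exists (delta R Pi).
- exact: diag_cvg.
- by rewrite hatE.
- by apply: cvg_lim prime_cvg.
- by rewrite /delta hatE.
Qed.
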